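(* Let $P\subset\mathbb{R}^n$ be a Delone set of finite local complexity. There exists $\epsilon$ with $0<\epsilon<1$ such that for all differentiable functions $\varphi:\mathbb{R}^n\to\mathbb{R}^n$ whose differential is strongly $P$-equivariant and satisfies $\|d(\varphi-\mathrm{id})\|_\infty<\epsilon$, the differential $d\varphi^{-1}$ of the inverse map $\varphi^{-1}$ is strongly $\varphi(P)$-equivariant.
   Context: $B(x,r)$ is the open ball in $\mathbb{R}^n$ and, for $P\subset\mathbb{R}^n$, $B_r[P]=B(0,r)\cap P$. $P$ is uniformly discrete if $\inf\{|x-y| : x\neq y\in P\}>0$, relatively dense if there is $r$ such that $B_r[P-x]\ne\emptyset$ for all $x\in\mathbb{R}^n$, and Delone if both. $P$ has finite local complexity if for every $r$ there are only finitely many distinct sets $B_r[P-x]$, $x\in P$. For a set $Q\subset\mathbb{R}^n$, a function $f$ on $\mathbb{R}^n$ is strongly $Q$-equivariant if there is a finite $R$ such that for all $x,y\in\mathbb{R}^n$, $B_R[Q-x]=B_R[Q-y]$ implies $f(x)=f(y)$. Differentials are viewed as functions on $\mathbb{R}^n$ with values in linear maps, and $\|d\eta\|_\infty$ is the supremum over $\mathbb{R}^n$ of the operator norm of $d\eta$. A differentiable map with $\|d(\varphi-\mathrm{id})\|_\infty<1$ is a bi-Lipschitz homeomorphism of $\mathbb{R}^n$, so $\varphi^{-1}$ is defined on $\mathbb{R}^n$. *)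

(* Defs.v *)
From HB Require Import structures.
From mathcomp Require Import all_boot all_order all_algebra.
From mathcomp Require Import all_classical all_reals all_analysis.

Set Implicit Arguments.
Unset Strict Implicit.
Unset Printing Implicit Defensive.

Import Order.TTheory GRing.Theory Num.Theory.
Import numFieldNormedType.Exports.

Local Open Scope classical_set_scope.
Local Open Scope ring_scope.

Section Patterns.
Context {R : realType} {n : nat}.
Implicit Types (P Q : set 'rV[R]_n) (x y : 'rV[R]_n) (r : R).

(* The norm `|x| that the library puts on 'rV[R]_n is the sup norm. All metric
   notions below use the Euclidean norm instead; differentiability and the
   differential are the same for both norms. *)
Definition enorm x : R := Num.sqrt (\sum_(i < n) x ord0 i ^+ 2).

Definition eball x r : set 'rV[R]_n := [set y | enorm (y - x) < r].

Definition translate P x : set 'rV[R]_n := [set p - x | p in P].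

Definition patch r P : set 'rV[R]_n := eball 0 r `&` P.

(* The infimum is taken in \bar R, so that it is +oo when P has at most one
   point. *)
Definition uniformly_discrete P : Prop :=
  (0 < ereal_inf [set (enorm (xy.1 - xy.2))%:E
                 | xy in [set xy | [/\ P xy.1, P xy.2 & xy.1 != xy.2]]])%E.

Definition relatively_dense P : Prop :=
  exists r, forall x, patch r (translate P x) !=set0.

Definition delone P : Prop := uniformly_discrete P /\ relatively_dense P.

Definition finite_local_complexity P : Prop :=
  forall r, finite_set [set patch r (translate P x) | x in P].

Definition strongly_equivariant (T : Type) Q (f : 'rV[R]_n -> T) : Prop :=
  exists r, forall x y,
    patch r (translate Q x) = patch r (translate Q y) -> f x = f y.

Definition opnorm (L : 'rV[R]_n -> 'rV[R]_n) : \bar R :=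
  ereal_sup [set (enorm (L v))%:E | v in [set v | enorm v <= 1]].

Definition differential (f : 'rV[R]_n -> 'rV[R]_n) (x : 'rV[R]_n) :
    'rV[R]_n -> 'rV[R]_n := 'd f x.

Definition sup_opnorm (df : 'rV[R]_n -> 'rV[R]_n -> 'rV[R]_n) : \bar R :=
  ereal_sup [set opnorm (df x) | x in setT].

End Patterns.

(* Main.v *)
Require Import Defs.
From HB Require Import structures.
From mathcomp Require Import all_boot all_order all_algebra.
From mathcomp Require Import all_classical all_reals all_analysis.
From mathcomp Require Import lra.

Set Implicit Arguments.
Unset Strict Implicit.
Unset Printing Implicit Defensive.

Import Order.TTheory GRing.Theory Num.Theory.
Import numFieldNormedType.Exports.

Local Open Scope classical_set_scope.
Local Open Scope ring_scope.

(** The differential of [psi = phi^-1] at [phi x] is the inverse of ['d phi x],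
    so it suffices that a large patch of [phi(P)] at [phi x] determines
    ['d phi x], and for this that it determines the patch of [P] at [x].

    Write [phi = id + eta]. The mean value inequality makes [eta] Lipschitz with
    a constant [K] proportional to [eps]. Finite local complexity and uniform
    discreteness leave finitely many vectors among the short differences
    [p' - p] of points of [P]; they are separated by some [delta > 0]. If two
    such differences [p' - p] and [q' - q] have the same image differences
    [phi p' - phi p = phi q' - phi q], they are within [K (|p' - p| + |q' - q|)]
    of each other, so they coincide once [K] is small with respect to [delta]
    ([perturbed_id_rigid]). This is the only constraint on [eps] besides those
    making [phi] invertible, and it depends on [P] alone.

    Rigidity is only about short differences, but relative density connects any
    two points of [P] by short hops ([relatively_dense_chain]). Hence if
    [phi(P)] looks the same around [phi p0] and [phi q0], with [p0] and [q0] in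
    [P], then [P] looks the same around [p0] and [q0]
    ([image_patch_transfer]).

    It remains to locate [x1] and [x2] with respect to the matched points
    ([image_agree_diff_eq]). Given matching patches of [phi(P)] at [phi x1] and
    [phi x2], take [p0] in [P] near [x1] and the [q0] whose image corresponds to
    [phi p0]. With [t = q0 - p0], the patches of [P] at [z] and [z + t] agree for
    [z] near [p0], so ['d phi z = 'd phi (z + t)] there. Integrating from [p0] to
    [x1] shows [phi (x1 + t) - phi q0 = phi x1 - phi p0 = phi x2 - phi q0],
    and injectivity gives [x2 = x1 + t].

    The estimates are carried out in the sup norm, which differs from the
    Euclidean one by a factor at most [n.+1]; the factor is absorbed in [eps] and
    in the radii of the patches. *)

(** * Euclidean patches and the sup norm *)

(** The join of the complete and normed structures of row vectors, under which
    they are a domain for the contraction fixed point theorem. *)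
HB.instance Definition _ (R : realType) (n : nat) :=
  Complete.copy 'rV[R]_n 'rV[R]_n.

Section Enorm.
Context {R : realType} {n : nat}.
Implicit Types (x : 'rV[R]_n) (Q : set 'rV[R]_n).

Lemma norm_coord x (i : 'I_n) : `|x ord0 i| <= `|x|.
Proof.
rewrite [leRHS]/Num.norm/= mx_normrE.
exact: (le_bigmax _ (fun ij : 'I_1 * 'I_n => `|x ij.1 ij.2|) (ord0, i)).
Qed.

Lemma norm_leP x (c : R) : 0 <= c ->
  (forall i, `|x ord0 i| <= c) -> `|x| <= c.
Proof.
move=> c0 xc; rewrite [leLHS]/Num.norm/= mx_normrE.
by apply/bigmax_leP; split => // -[i j] _ /=; rewrite (ord1 i).
Qed.

Lemma norm_enorm x : `|x| <= enorm x.
Proof.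
apply: norm_leP => [|i]; first exact: sqrtr_ge0.
rewrite -sqrtr_sqr ler_sqrt; last by apply: sumr_ge0 => j _; exact: sqr_ge0.
rewrite (bigD1 i)//= lerDl; apply: sumr_ge0 => j _; exact: sqr_ge0.
Qed.

Lemma enorm_norm x : enorm x <= n.+1%:R * `|x|.
Proof.
have c0 : 0 <= n.+1%:R * `|x| by rewrite mulr_ge0.
rewrite -(ger0_norm c0) -sqrtr_sqr ler_sqrt; last exact: sqr_ge0.
apply: (@le_trans _ _ (\sum_(i < n) `|x| ^+ 2)).
  apply: ler_sum => i _; rewrite -real_normK ?num_real//.
  by rewrite lerXn2r ?nnegrE ?norm_coord.
rewrite sumr_const card_ord -[leLHS]mulr_natl exprMn.
rewrite ler_wpM2r ?sqr_ge0// -natrX ler_nat (leq_trans (leqnSn n))//.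
by rewrite -[leqLHS]expn1 leq_pexp2l.
Qed.

Lemma translateE Q x v : translate Q x v <-> Q (x + v).
Proof.
split=> [[p Qp <-]|Qxv]; first by rewrite addrC subrK.
by exists (x + v) => //; rewrite addrC addKr.
Qed.

Lemma patch_translateE Q r x v :
  Defs.patch r (translate Q x) v <-> enorm v < r /\ Q (x + v).
Proof.
by rewrite /Defs.patch /eball /setI /= subr0; split => -[? ?]; split => //;
  apply/translateE.
Qed.

End Enorm.

(** Equality of the patches of radius [r] at [x] and [y], for the ambient norm. *)
Definition agree_within {R : realType} {V : normedModType R}
    (Q : set V) (r : R) (x y : V) :=
  forall v, `|v| < r -> (Q (x + v) <-> Q (y + v)).

Section Agree.
Context {R : realType} {n : nat}.
Implicit Types (x y : 'rV[R]_n) (Q : set 'rV[R]_n).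

Lemma agree_patch_eq Q r x y :
  agree_within Q r x y ->
  Defs.patch r (translate Q x) = Defs.patch r (translate Q y).
Proof.
move=> xy; apply/seteqP; split => v /patch_translateE[vr Qv];
  apply/patch_translateE; split => //; apply/(xy v) => //;
  exact: le_lt_trans (norm_enorm v) vr.
Qed.

Lemma patch_eq_agree Q r x y :
  Defs.patch (n.+1%:R * r) (translate Q x) =
    Defs.patch (n.+1%:R * r) (translate Q y) ->
  agree_within Q r x y.
Proof.
move=> E v vr.
have ev : enorm v < n.+1%:R * r.
  by apply: le_lt_trans (enorm_norm v) _; rewrite ltr_pM2l.
split=> Qv.
  have /patch_translateE[] // : Defs.patch (n.+1%:R * r) (translate Q y) v.
  by rewrite -E; apply/patch_translateE.
have /patch_translateE[] // : Defs.patch (n.+1%:R * r) (translate Q x) v.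
by rewrite E; apply/patch_translateE.
Qed.

End Agree.

(** Only vectors of Euclidean norm at most 1 enter the operator norm; the vector
    [v] is brought there by dividing it by [n.+1 * `|v|]. *)
Lemma sup_opnorm_norm_le (R : realType) (n : nat)
    (df : 'rV[R]_n -> {linear 'rV[R]_n -> 'rV[R]_n}) (eps : R) :
  (sup_opnorm (fun x v => df x v) < eps%:E)%E ->
  forall x v, `|df x v| <= n.+1%:R * eps * `|v|.
Proof.
move=> dfe x v; have [->|v0] := eqVneq v 0.
  by rewrite linear0 !normr0 mulr0.
have c0 : 0 < n.+1%:R * `|v| by rewrite mulr_gt0 ?normr_gt0.
pose u := (n.+1%:R * `|v|)^-1 *: v.
have nu : enorm u <= 1.
  rewrite (le_trans (enorm_norm u))// normrZ gtr0_norm ?invr_gt0//.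
  by rewrite mulrCA mulVf ?gt_eqF.
have : `|df x u| < eps.
  rewrite (le_lt_trans (norm_enorm _))// -lte_fin (le_lt_trans _ dfe)//.
  apply: (@le_trans _ _ (opnorm (df x))); apply: ereal_sup_ubound.
    by exists u.
  by exists x.
rewrite linearZ normrZ gtr0_norm ?invr_gt0// mulrC ltr_pdivrMr// => /ltW.
by rewrite mulrCA mulrA.
Qed.

(** * Differential calculus *)

Lemma diff_sub_id (R : realType) (V : normedModType R) (f : V -> V) (x v : V) :
  differentiable f x -> 'd (f \- id) x v = 'd f x v - v.
Proof.
move=> df.
have di : is_diff x (id : V -> V) id by exact: is_diff_id.
have dfx : is_diff x f ('d f x) by exact: differentiableP.
by have := @diff_val _ _ _ _ _ _ _ (is_diffB dfx di) => /(congr1 (@^~ v)).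
Qed.

Lemma diff_translate (R : realType) (V W : normedModType R) (f : V -> W)
    (a x : V) :
  differentiable f (x + a) ->
  is_diff x (fun z => f (z + a)) ('d f (x + a)).
Proof.
move=> df.
have dt : is_diff x (fun z : V => z + a) id.
  have di : is_diff x (id : V -> V) id by exact: is_diff_id.
  have -> : (id : V -> V) = id + 0 by apply/funext => z; rewrite /= addr0.
  exact: (is_diffD di (is_diff_cst a x)).
have dfx : is_diff (x + a) f ('d f (x + a)) by exact: differentiableP.
exact: (is_diff_comp dt dfx).
Qed.

Lemma diff_cancel (R : realType) (V W : normedModType R) (f : V -> W)
    (g : W -> V) (x h : V) :
  cancel f g -> differentiable f x -> differentiable g (f x) ->
  'd g (f x) ('d f x h) = h.
Proof.
move=> fg df dg.
have E : 'd (g \o f) x h = h.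
  have -> : g \o f = id by apply/funext => z /=; rewrite fg.
  have di : is_diff x (id : V -> V) id by exact: is_diff_id.
  by rewrite diff_val.
by rewrite -[RHS]E; exact: (congr1 (@^~ h) (esym (diff_comp df dg))).
Qed.

Lemma is_diff_coord (R : realType) (m : nat) (i : 'I_m) (y : 'rV[R]_m) :
  is_diff y (fun z : 'rV[R]_m => z ord0 i : R) (fun z => z ord0 i).
Proof.
apply: DiffDef; first exact: differentiable_coord.
have coord_lin : linear (fun z : 'rV[R]_m => z ord0 i).
  by move=> a u v; rewrite !mxE.
pose coordM := GRing.isLinear.Build _ _ _ _ _ coord_lin.
pose coordL : {linear 'rV[R]_m -> R} :=
  HB.pack (fun z : 'rV[R]_m => z ord0 i) coordM.
apply: (diff_lin (f := coordL)).
exact: coord_continuous.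
Qed.

(** Mean value inequality. The sup norm of the target lets the one-variable mean
    value theorem be applied to one coordinate at a time. *)
Lemma norm_increment_le (R : realType) (V : normedModType R) (m : nat)
    (f : V -> 'rV[R]_m) (x v : V) (C : R) :
  (forall z, differentiable f z) ->
  (forall t, 0 <= t <= 1 -> `|'d f (x + t *: v) v| <= C) ->
  `|f (x + v) - f x| <= C.
Proof.
move=> df dC.
have C0 : 0 <= C by apply: le_trans (dC 0 _); rewrite ?lexx ?ler01.
apply: norm_leP => // i.
pose l := fun t : R => x + t *: v.
pose g := fun t : R => f (l t) ord0 i.
have gd t : is_derive t (1 : R) g ('d f (l t) v ord0 i).
  have dl : is_diff t l ( *:%R^~ v).
    rewrite (_ : ( *:%R^~ v) = 0 + ( *:%R^~ v)); last by rewrite add0r.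
    rewrite (_ : l = cst x + ( *:%R^~ v)); last by apply/funext => s.
    have ds : is_diff t ( *:%R^~ v : R -> V) ( *:%R^~ v) := is_diff_scalel _ _.
    exact: is_diffD.
  have dfl : is_diff (l t) f ('d f (l t)) by exact: differentiableP.
  have dc := is_diff_coord i (f (l t)).
  have dg : is_diff t g ((fun z => z ord0 i) \o ('d f (l t) \o *:%R^~ v)).
    exact: (@is_diff_comp _ _ _ _ (f \o l)).
  have gdf : differentiable g t by exact: ex_diff.
  apply: DeriveDef; first exact: diff_derivable.
  by rewrite deriveE// diff_val /= scale1r.
have [|t t01] := @MVT_segment R g (fun t => 'd f (l t) v ord0 i) 0 1 ler01
  (fun t _ => gd t).
  by apply: derivable_within_continuous => t _; exact: ex_derive.
rewrite /g /l scale1r scale0r addr0 subr0 mulr1 => E.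
rewrite !mxE E; apply: le_trans (norm_coord _ _) (dC _ _).
by move: t01; rewrite in_itv.
Qed.

(** * Lipschitz perturbations of the identity *)

Lemma subrACA (V : zmodType) (a b c d : V) :
  (a - b) - (c - d) = (a - c) - (b - d).
Proof. by rewrite opprD addrACA -opprD. Qed.

Section PerturbedIdentity.
Context {R : realType} {V : completeNormedModType R}.
Variables (f : V -> V) (K : R).
Hypothesis K2 : K <= 2^-1.
Hypothesis fK : forall x y, `|(f x - x) - (f y - y)| <= K * `|x - y|.

Let half x y : `|(f x - x) - (f y - y)| <= 2^-1 * `|x - y|.
Proof. exact: le_trans (fK x y) (ler_wpM2r _ _). Qed.

Lemma perturbed_id_expand x y : `|x - y| <= 2 * `|f x - f y|.
Proof.
have := half x y.
rewrite subrACA.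
have := ler_distD (f x - f y) (x - y) 0; rewrite !subr0 distrC.
lra.
Qed.

Lemma perturbed_id_lip x y : `|f x - f y| <= 2 * `|x - y|.
Proof.
have := half x y.
rewrite subrACA.
have := ler_distD (x - y) (f x - f y) 0; rewrite !subr0.
have := normr_ge0 (x - y); lra.
Qed.

(** Solving [f x = y] amounts to finding a fixed point of the contraction
    [x |-> y - (f x - x)]. *)
Lemma perturbed_id_bij : exists g, cancel f g /\ cancel g f.
Proof.
have inj x y : f x = f y -> x = y.
  move=> fxy; have := perturbed_id_expand x y.
  by rewrite fxy subrr normr0 mulr0 normr_le0 subr_eq0 => /eqP.
have surj y : exists x, f x = y.
  pose T x : V := y - (f x - x).
  have TU : set_fun setT setT T by [].
  pose Tm := isFun.Build _ _ _ _ T TU.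
  pose F : {fun [set: V] >-> [set: V]} := HB.pack T Tm.
  have ctr : is_contraction F.
    exists (2^-1%:nng); split => /=; first by rewrite invf_lt1 ?ltr1n.
    move=> [u v] _ /=; rewrite /T [X in `|X|](_ : _ = (f v - v) - (f u - u)).
      by rewrite distrC.
    by rewrite [- (y - _)]opprB [LHS]addrC addrA subrK.
  have [x _ Fx] := banach_fixed_point ctr closedT (ex_intro _ 0 I).
  have xT : x = y - (f x - x) by exact: Fx.
  by exists x; rewrite -[LHS](subrK x) [X in _ + X = _]xT addrC subrK.
exists (fun y => sval (cid (surj y))); split => [x|y]; last by case: cid.
by apply: inj; case: cid.
Qed.

End PerturbedIdentity.

(** The differential [L] of [f] is itself a perturbation of the identity, so it
    has a bounded inverse [M]. With [h = g (k + f x) - x], the error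
    [h - M k = - M (k - L h)] is [o(h)], hence [o(k)] since [g] is Lipschitz. *)
Lemma differentiable_perturbed_inverse (R : realType)
    (V : completeNormedModType R) (f g : V -> V) (x : V) :
  cancel f g -> cancel g f -> differentiable f x ->
  (forall y z, `|y - z| <= 2 * `|f y - f z|) ->
  (forall v, `|'d f x v - v| <= 2^-1 * `|v|) ->
  differentiable g (f x).
Proof.
move=> fg gf df f2 dfx.
set L := 'd f x.
have LK u v : `|(L u - u) - (L v - v)| <= 2^-1 * `|u - v|.
  by rewrite subrACA -linearB dfx.
have [M [LM ML]] := perturbed_id_bij (lexx _) LK.
have Mlin : linear M := can2_linear LM ML.
pose Mm := GRing.isLinear.Build _ _ _ _ _ Mlin.
pose Mlinear : {linear V -> V} := HB.pack M Mm.
have M2 k : `|M k| <= 2 * `|k|.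
  have := perturbed_id_expand (lexx _) LK (M k) 0.
  by rewrite ML [L 0]linear0 !subr0.
have Mc : continuous M.
  apply: (bounded_linear_continuous (f := Mlinear)); apply/bounded_funP => r.
  by exists (2 * r) => k kr; rewrite (le_trans (M2 k))// ler_pM2l.
have Mo : g \o shift (f x) = cst (g (f x)) + Mlinear +o_ 0 id.
  apply/eqaddoP => e e0.
  have e4 : 0 < e / 4 by rewrite divr_gt0.
  have /eqaddoP /(_ _ e4) /nbhs_normP[d /= d0 fd] := diff_locally df.
  apply/nbhs_normP; exists (d / 2) => /=; first by rewrite divr_gt0.
  move=> k /=; rewrite sub0r normrN => kd.
  pose h := g (k + f x) - x.
  have fh : f (h + x) = k + f x by rewrite /h subrK gf.
  have hk : `|h| <= 2 * `|k|.
    by rewrite -[h](addrK x) (le_trans (f2 _ _))// fh addrK.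
  have /fd /= : ball_ (fun v : V => `|v|) 0 d h.
    by rewrite /ball_/= sub0r normrN (le_lt_trans hk)// mulrC -ltr_pdivlMr.
  rewrite !fctE /= fh fg -/L => rh.
  have -> : g (k + f x) - (x + M k) = - M (k + f x - (f x + L h)).
    rewrite addrKA (linearB Mlinear : forall u w, M (u - w) = M u - M w) LM opprB.
    by rewrite opprD addrA.
  rewrite normrN (le_trans (M2 _))//.
  have := normr_ge0 k; nra.
by apply/diff_locallyP; rewrite (diff_unique _ Mo).
Qed.

(** * Discrete sets of points *)

Lemma finite_norm_gap (R : realType) (V : normedModType R) (D : set V) :
  finite_set D ->
  exists2 delta : R, 0 < delta &
    forall d e, D d -> D e -> `|d - e| < delta -> d = e.
Proof.
move=> finD.
have /finite_seqP[s As] := finite_image2 (fun d e => `|d - e|) finD finD.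
exists (\big[Num.min/1]_(x <- s | 0 < x) x); first exact: lt_bigmin.
move=> d e Dd De; apply: contraPP => /eqP de; apply/negP; rewrite -leNgt.
apply: ge_bigmin_seq; last by rewrite normr_gt0 subr_eq0.
suff : [set `|x - y| | x in D & y in D] `|d - e| by rewrite As.
by exists d => //; exists e.
Qed.

(** A compact ball is covered by finitely many balls of radius [s / 2], each of
    which contains at most one point of [A]. *)
Lemma separated_bounded_finite (R : realType) (n : nat) (A : set 'rV[R]_n)
    (r s : R) :
  0 < s -> (forall u v, A u -> A v -> `|u - v| < s -> u = v) ->
  (forall v, A v -> `|v| <= r) -> finite_set A.
Proof.
move=> s0 sepA bndA.
have : compact (closed_ball_ Num.norm (0 : 'rV[R]_n) r).
  apply: bounded_closed_compact; last exact: closed_closed_ball_.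
  exists r; split; first exact: num_real.
  move=> M /ltW rM v; rewrite /closed_ball_/= sub0r normrN => vr.
  exact: le_trans vr rM.
rewrite compact_cover => cK.
have [D finD Kcov] : exists2 D : set 'rV[R]_n, finite_set D &
    closed_ball_ Num.norm 0 r `<=` \bigcup_(c in D) ball c (s / 2).
  have [||D' _ Kcov] := cK _ setT (fun c : 'rV[R]_n => ball c (s / 2)).
  - by move=> c _; exact: ball_open.
  - by move=> v _; exists v => //; apply: ballxx; rewrite divr_gt0.
  - by eexists; last exact: Kcov; exact: finite_fset.
have subA : A `<=` \bigcup_(c in D) (A `&` ball c (s / 2)).
  move=> v Av; have [|c Dc cv] := Kcov v; last by exists c.
  by rewrite /closed_ball_/= sub0r normrN bndA.
apply: sub_finite_set subA _; apply: bigcup_finite => // c _.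
have [[v0 [Av0 cv0]]|/nonemptyPn ->] := pselect (A `&` ball c (s / 2) !=set0).
  apply: (@sub_finite_set _ _ [set v0]) (finite_set1 _) => v [Av cv] /=.
  apply: sepA => //; rewrite -ball_normE in cv0 cv.
  rewrite (le_lt_trans (ler_distD c _ _))// (splitr s) ltrD//.
  by rewrite distrC.
exact: finite_set0.
Qed.

Section DeloneNorm.
Context {R : realType} {n : nat}.
Variable P : set 'rV[R]_n.

Lemma uniformly_discrete_norm : uniformly_discrete P ->
  exists2 s : R, 0 < s & forall p q, P p -> P q -> `|p - q| < s -> p = q.
Proof.
rewrite /uniformly_discrete; set m := ereal_inf _ => m0.
have [c c0 cm] : exists2 c : R, 0 < c & (c%:E <= m)%E.
  move: m0; case: m => [c|_|//]; last by exists 1; rewrite ?leey.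
  by rewrite lte_fin => c0; exists c.
exists (c / n.+1%:R); first by rewrite divr_gt0.
move=> p q Pp Pq; apply: contraPP => /eqP pq; apply/negP; rewrite -leNgt.
rewrite ler_pdivrMr// mulrC; apply: le_trans (enorm_norm _).
rewrite -lee_fin; apply: le_trans cm _; apply: ereal_inf_lbound.
by exists (p, q).
Qed.

Lemma relatively_dense_norm : relatively_dense P ->
  exists2 s : R, 0 < s & forall x, exists2 p, P p & `|p - x| < s.
Proof.
move=> [s Ps]; have Ps' x : exists2 p, P p & `|p - x| < s.
  have [v /patch_translateE[vs Pv]] := Ps x; exists (x + v) => //.
  by rewrite addrC addKr (le_lt_trans (norm_enorm v)).
by exists s => //; have [p _] := Ps' 0; exact: le_lt_trans.
Qed.

(** The differences shorter than [r] lie in the union of the patches of [P] at its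
    own points: finitely many patches, each of them finite. *)
Lemma local_differences_finite (r : R) :
  uniformly_discrete P -> finite_local_complexity P ->
  finite_set [set v | `|v| < r /\ exists2 p, P p & P (p + v)].
Proof.
move=> /uniformly_discrete_norm[s s0 sepP] flc.
apply: sub_finite_set (bigcup_finite (F := id) (flc (n.+1%:R * r)) _); last first.
  move=> _ [p Pp <-]; apply: (separated_bounded_finite (r := n.+1%:R * r) s0).
    move=> u v /patch_translateE[_ Pu] /patch_translateE[_ Pv] uv.
    apply: (addrI p); apply: sepP => //.
    by rewrite opprD addrACA subrr add0r.
  by move=> v /patch_translateE[/ltW vr _]; exact: le_trans (norm_enorm v) vr.
move=> v [vr [p Pp Ppv]]; exists (Defs.patch (n.+1%:R * r) (translate P p)).
  by exists p.
apply/patch_translateE; split => //.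
by apply: le_lt_trans (enorm_norm v) _; rewrite ltr_pM2l.
Qed.

End DeloneNorm.

(** * Recovering a point set from its image *)

Section Transfer.
Context {R : realType} {V : normedModType R}.
Variables (P : set V) (s : R).
Hypothesis densP : forall x, exists2 p, P p & `|p - x| < s.

(** Induction on the distance to [p0]: if [p] is far from [p0], some point of [P]
    is within [s] of the point at distance [2 * s] from [p] on the segment from
    [p] to [p0]. It is at most [3 * s] away from [p], and closer to [p0] than [p]
    by at least [s]; in particular the chain never leaves the ball of radius
    [rho]. *)
Lemma relatively_dense_chain (A : set V) (p0 : V) (rho : R) :
  A p0 -> P p0 ->
  (forall p q, P p -> A p -> P q -> `|q - p| < 3 * s -> `|q - p0| < rho ->
     A q) ->
  forall p, P p -> `|p - p0| < rho -> A p.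
Proof.
move=> Ap0 Pp0 hop p.
have s0 : 0 < s by have [q _] := densP 0; exact: le_lt_trans.
have [k] : exists k : nat, `|p - p0| < k%:R * s.
  exists (Num.truncn (`|p - p0| / s)).+1.
  by rewrite -ltr_pdivrMr// truncnS_gt.
elim: k p => [|k IH] p pk Pp prho.
  by move: pk; rewrite mul0r normr_lt0.
have [p3|p3] := ltP `|p - p0| (3 * s); first exact: (hop p0).
have pp0 : 0 < `|p - p0| by apply: lt_le_trans p3; rewrite mulr_gt0.
pose u := (2 * s / `|p - p0|) *: (p - p0).
have [q Pq qz] := densP (p - u).
have nu : `|u| = 2 * s.
  by rewrite normrZ ger0_norm ?divfK ?gt_eqF// divr_ge0 ?mulr_ge0 ?ltW.
have nz : `|p - u - p0| = `|p - p0| - 2 * s.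
  have -> : p - u - p0 = (1 - 2 * s / `|p - p0|) *: (p - p0).
    by rewrite scalerBl scale1r addrAC.
  rewrite normrZ ger0_norm; last first.
    rewrite subr_ge0 ler_pdivrMr// mul1r; lra.
  by rewrite mulrBl mul1r divfK ?gt_eqF.
have qp0 : `|q - p0| < `|p - p0| - s.
  by have := ler_distD (p - u) q p0; rewrite nz; lra.
apply: (hop q) => //.
  apply: IH => //.
    by move: pk; rewrite -natr1 mulrDl mul1r; lra.
  by lra.
by have := ler_distD (p - u) p q; rewrite subKr nu [`|p - u - q|]distrC; lra.
Qed.

Variable f : V -> V.
Hypothesis f_lip : forall x y, `|f x - f y| <= 2 * `|x - y|.
Hypothesis f_rigid : forall p p' q q', P p -> P p' -> P q -> P q' ->
  `|p' - p| < 3 * s -> f p' - f p = f q' - f q -> p' - p = q' - q.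

(** Points [p] of [P] near [p0] are matched with the points [q] of [P] such that
    [f q - f q0 = f p - f p0]. By rigidity a hop from [p] to [p'] and the
    corresponding hop from [q] to [q'] are the same vector, so [q - p] is constant
    along a chain of hops, equal to [q0 - p0]. *)
Lemma image_patch_transfer (rho : R) (p0 q0 : V) : P p0 -> P q0 ->
  (forall w, `|w| < 2 * rho -> (f @` P) (f p0 + w) -> (f @` P) (f q0 + w)) ->
  forall v, `|v| < rho -> P (p0 + v) -> P (q0 + v).
Proof.
move=> Pp0 Pq0 fP v vr Pv.
pose A := [set p | exists q,
  [/\ P q, q - q0 = p - p0 & f q - f q0 = f p - f p0]].
have [||||q [Pq qq0 _]] := @relatively_dense_chain A p0 rho _ _ _ (p0 + v) Pv.
- by exists q0; rewrite !subrr.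
- by [].
- move=> p p' Pp [q [Pq qp fqp]] Pp' pp' p'r.
  have [] := fP (f p' - f p0).
  + by apply: le_lt_trans (f_lip _ _) _; rewrite ltr_pM2l.
  + by exists p' => //; rewrite addrC subrK.
  move=> q' Pq' fq'.
  have E : q' - q = p' - p.
    apply/esym/f_rigid => //; rewrite fq'.
    by rewrite addrAC -[f q0 - _]opprB fqp opprB addrC addrA subrK.
  exists q'; split => //.
    by rewrite -(subrKA q) E qp addrA subrK.
  by rewrite fq' addrC addKr.
- by rewrite addrC addKr.
by move: Pq; rewrite -(subrK q0 q) qq0 [p0 + v]addrC addrK addrC.
Qed.

End Transfer.

(** The image differences being equal, [(p' - p) - (q' - q)] is the difference of
    the increments of [f - id] from [q] to [q'] and from [p] to [p'], of norm at
    most [K (|p' - p| + |q' - q|)]. As [|q' - q| <= 2 |f q' - f q| =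
    2 |f p' - f p| <= 4 |p' - p| < 12 s], this is less than [K * 15 s]. *)
Lemma perturbed_id_rigid (R : realType) (V : normedModType R)
    (P : set V) (f : V -> V) (s K delta : R) :
  0 < K -> K * (15 * s) <= delta ->
  (forall x y, `|x - y| <= 2 * `|f x - f y|) ->
  (forall x y, `|f x - f y| <= 2 * `|x - y|) ->
  (forall x y, `|(f x - x) - (f y - y)| <= K * `|x - y|) ->
  (let D := [set v | `|v| < 12 * s /\ exists2 p, P p & P (p + v)] in
   forall d e, D d -> D e -> `|d - e| < delta -> d = e) ->
  forall p p' q q', P p -> P p' -> P q -> P q' ->
  `|p' - p| < 3 * s -> f p' - f p = f q' - f q -> p' - p = q' - q.
Proof.
move=> K0 Kd f2 fl fK gap p p' q q' Pp Pp' Pq Pq' pp' E.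
have qq' : `|q' - q| < 12 * s.
  have := f2 q' q; rewrite -E; have := fl p' p; lra.
apply: gap.
- split; first by have := normr_ge0 (p' - p); lra.
  by exists p => //; rewrite addrC subrK.
- by split => //; exists q => //; rewrite addrC subrK.
have -> : (p' - p) - (q' - q) =
    ((f q' - q') - (f q - q)) - ((f p' - p') - (f p - p)).
  rewrite (subrACA (f q')) (subrACA (f p')) E.
  by rewrite (subrACA (f q' - f q)) subrr sub0r opprB.
apply: le_lt_trans (ler_normB _ _) _.
have := fK q' q; have := fK p' p.
suff : K * `|p' - p| + K * `|q' - q| < delta by lra.
have := normr_ge0 (p' - p).
nra.
Qed.

(** The radius [2 * rho + 2 * s] is what the argument consumes: an image [f p0]
    lies within [2 * s] of [f x1], and an [f]-image of the ball of radius [rho]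
    around [p0] lies within [2 * rho] of [f p0]. In turn [rho = r + s] covers the
    [r]-balls around all points of the segment from [p0] to [x1]. *)
Lemma image_agree_diff_eq (R : realType) (n : nat) (P : set 'rV[R]_n) (s r : R)
    (f : 'rV[R]_n -> 'rV[R]_n) :
  (forall x, exists2 p, P p & `|p - x| < s) ->
  (forall x, differentiable f x) -> injective f ->
  (forall x y, `|f x - f y| <= 2 * `|x - y|) ->
  (forall p p' q q', P p -> P p' -> P q -> P q' ->
     `|p' - p| < 3 * s -> f p' - f p = f q' - f q -> p' - p = q' - q) ->
  0 <= r ->
  (forall x y, agree_within P r x y ->
     'd f x = 'd f y :> ('rV[R]_n -> 'rV[R]_n)) ->
  let rho := r + s in
  forall x1 x2, agree_within (f @` P) (2 * rho + 2 * s) (f x1) (f x2) ->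
  'd f x1 = 'd f x2 :> ('rV[R]_n -> 'rV[R]_n).
Proof.
move=> densP df f_inj fl rigid r_ge0 eqvP rho x1 x2 agr.
have s0 : 0 < s by have [p _] := densP 0; exact: le_lt_trans.
have [p0 Pp0 p0x1] := densP x1.
pose w0 := f p0 - f x1.
have w0s : `|w0| < 2 * s by have := fl p0 x1; rewrite -/w0; lra.
have w0E z : f x1 + (w0 + z) = f p0 + z.
  by rewrite addrA [f x1 + _]addrC subrK.
have [] : (f @` P) (f x2 + w0).
  apply: (agr w0 _).1; first by rewrite /rho; lra.
  by exists p0; rewrite // -[w0]addr0 w0E addr0.
move=> q0 Pq0 q0E.
have pq w : `|w| < 2 * rho ->
    ((f @` P) (f p0 + w) <-> (f @` P) (f q0 + w)).
  move=> wr; rewrite -w0E q0E -(addrA (f x2)); apply: agr.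
  by rewrite (le_lt_trans (ler_normD _ _))// addrC ltrD.
have agrP : agree_within P rho p0 q0.
  move=> v vr; split;
    apply: (image_patch_transfer densP fl rigid (rho := rho)) => //.
    by move=> w /pq[].
  by move=> w /pq[].
pose t := q0 - p0.
have dft z : `|z - p0| < s ->
    'd f z = 'd f (z + t) :> ('rV[R]_n -> 'rV[R]_n).
  move=> zs; apply: eqvP => v vr.
  have := agrP (z - p0 + v).
  rewrite addrA [p0 + _]addrC subrK addrA [q0 + _]addrCA -/t; apply.
  by rewrite (le_lt_trans (ler_normD _ _))// /rho addrC ltrD.
(* The map [f y - f (y + t)] has zero differential on the segment [p0, x1]. *)
have x2E : x2 = x1 + t.
  apply: f_inj.
  have dg z : is_diff z (fun y => f y - f (y + t))
      (fun v => 'd f z v - 'd f (z + t) v).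
    have d1 : is_diff z f ('d f z) by exact: differentiableP.
    exact: is_diffB d1 (diff_translate (df _)).
  have p0x : p0 + (x1 - p0) = x1 by rewrite addrC subrK.
  have : `|(f x1 - f (x1 + t)) - (f p0 - f (p0 + t))| <= 0.
    have := @norm_increment_le R _ n _ p0 (x1 - p0) 0
      (fun z => @ex_diff _ _ _ _ _ _ _ (dg z)).
    rewrite p0x /=; apply => u /andP[u0 u1].
    set v := x1 - p0; set z := p0 + u *: v.
    have zs : `|z - p0| < s.
      rewrite /z addrC addKr normrZ ger0_norm// /v distrC.
      by rewrite (le_lt_trans _ p0x1)// ler_piMl.
    have dfz : 'd f z v - 'd f (z + t) v = 0.
      have dfE := congr1 (fun L : 'rV[R]_n -> 'rV[R]_n => L v) (dft z zs).
      by apply/eqP; rewrite subr_eq0; apply/eqP.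
    have := congr1 (@^~ v) (@diff_val _ _ _ _ _ _ _ (dg z)).
    by rewrite /= dfz => ->; rewrite normr0.
  rewrite normr_le0 subr_eq0 [p0 + _]addrC subrK q0E => /eqP.
  have -> : f p0 - (f x2 + w0) = f x1 - f x2.
    by rewrite /w0 addrCA opprD addrA subrr sub0r opprB.
  by move=> /addrI/oppr_inj.
by rewrite x2E; apply: dft; rewrite distrC.
Qed.

Theorem corollary4p19 (R : realType) (n : nat) (P : set 'rV[R]_n)
    (hD : delone P) (hF : finite_local_complexity P) :
  exists eps : R, [/\ 0 < eps, eps < 1 &
    forall phi : 'rV[R]_n -> 'rV[R]_n,
      (forall x : 'rV[R]_n, differentiable phi x) ->
      strongly_equivariant P (differential phi) ->
      (sup_opnorm (differential (phi \- id)%R) < eps%:E)%E ->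
      exists psi : 'rV[R]_n -> 'rV[R]_n,
        [/\ cancel phi psi, cancel psi phi,
            forall y : 'rV[R]_n, differentiable psi y &
            strongly_equivariant (phi @` P) (differential psi)]].
Proof.
have [udP rdP] := hD.
have [s s0 densP] := relatively_dense_norm rdP.
have [delta delta0 gap] :=
  finite_norm_gap (local_differences_finite (12 * s) udP hF).
(* [K] bounds the Lipschitz constant of [phi - id]; [2^-1] makes [phi] invertible
   and [delta / (15 * s)] makes it rigid. *)
pose K := Num.min 2^-1 (delta / (15 * s)).
have K0 : 0 < K by rewrite lt_min invr_gt0 ltr0n divr_gt0// mulr_gt0.
have K2 : K <= 2^-1 by rewrite ge_min lexx.
have Kd : K * (15 * s) <= delta.
  by rewrite -ler_pdivlMr ?mulr_gt0// ge_min lexx orbT.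
have n0 : 0 < n.+1%:R :> R by rewrite ltr0n.
exists (K / n.+1%:R); split; first by rewrite divr_gt0.
  rewrite ltr_pdivrMr// mul1r (@lt_le_trans _ _ 1) ?ler1n//.
  by rewrite (le_lt_trans K2)// invf_lt1 ?ltr1n.
move=> phi dphi [r0 eqvP] supphi.
have etad x v : `|'d phi x v - v| <= K * `|v|.
  rewrite -diff_sub_id//.
  have := sup_opnorm_norm_le supphi x v.
  by rewrite [n.+1%:R * _]mulrC divfK ?gt_eqF.
have deta x : differentiable (phi \- id) x by exact: differentiableB.
have etaK x y : `|(phi x - x) - (phi y - y)| <= K * `|x - y|.
  have := @norm_increment_le R _ n (phi \- id) y (x - y) (K * `|x - y|) deta.
  rewrite [y + _]addrC subrK; apply => t _.
  by rewrite diff_sub_id.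
have f2 := perturbed_id_expand K2 etaK.
have fl := perturbed_id_lip K2 etaK.
have rigid := perturbed_id_rigid K0 Kd f2 fl etaK gap.
have [psi [phiK psiK]] := perturbed_id_bij K2 etaK.
have dpsi y : differentiable psi y.
  rewrite -(psiK y); apply: differentiable_perturbed_inverse => // v.
  by rewrite (le_trans (etad _ _))// ler_wpM2r.
exists psi; split => //.
(* Nothing prevents the given equivariance radius from being negative. *)
pose r := Num.max r0 0.
have r0r : r0 <= r by rewrite le_max lexx.
have r_ge0 : 0 <= r by rewrite le_max lexx orbT.
have eqv_r x y : agree_within P r x y ->
    'd phi x = 'd phi y :> ('rV[R]_n -> 'rV[R]_n).
  move=> xy; apply: eqvP; apply: agree_patch_eq => v vr.
  by apply: xy; exact: lt_le_trans vr r0r.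
have rho_eqv :=
  image_agree_diff_eq densP dphi (can_inj phiK) fl rigid r_ge0 eqv_r.
exists (n.+1%:R * (2 * (r + s) + 2 * s)) => y1 y2.
rewrite -{1}(psiK y1) -{1}(psiK y2) => yy.
have E := rho_eqv _ _ (patch_eq_agree yy); apply/funext => k.
rewrite /differential.
(* [psi y1] and [psi y2] have the same ['d phi], so both values are its unique
   preimage of [k]. *)
have L2 : 'd phi (psi y1) ('d psi y2 k) = k.
  rewrite (congr1 (@^~ ('d psi y2 k)) E).
  exact: (@diff_cancel _ _ _ psi phi y2 k psiK (dpsi _) (dphi _)).
have := @diff_cancel _ _ _ phi psi (psi y1) ('d psi y2 k) phiK (dphi _)
  (dpsi _).
rewrite psiK => L1.
exact: etrans (congr1 ('d psi y1) (esym L2)) L1.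
Qed.
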